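(* $\zeta_{\rm clique}(3) \ge 2\cdot\left(\frac{1}{3}\right)^{1/3}\cdot\left(\frac{2}{3}\right)^{2/3} = 1.058\ldots$
   Context: A distance graph in $\mathbb{R}^n$ is a graph $G=(V,E)$ with $V\subseteq\mathbb{R}^n$ and, for some real $a>0$, $E\subseteq\{\{x,y\}: x,y\in V,\ |x-y|=a\}$, where $|\cdot|$ is the Euclidean norm. $\chi(G)$ is the chromatic number and $\omega(G)$ the clique number (maximum size of a complete subgraph). For an integer $k$, $\zeta_{\rm clique}(k)$ is the supremum of all real $\zeta$ for which there exists a function $\delta(n)$ with $\lim_{n\to\infty}\delta(n)=0$ such that for every $n$ there is a distance graph $G$ in $\mathbb{R}^n$ with $\omega(G)<k$ and $\chi(G)\ge(\zeta+\delta(n))^n$. *)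

(* Defs.v *)
From mathcomp Require Import all_boot all_order all_algebra finmap.
From mathcomp Require Import all_classical all_reals all_analysis.

Set Implicit Arguments.
Unset Strict Implicit.
Unset Printing Implicit Defensive.

Import Order.TTheory GRing.Theory Num.Theory.
Import numFieldNormedType.Exports.

Local Open Scope classical_set_scope.
Local Open Scope ring_scope.

(* The canonical norm `|x| on 'rV[R]_n is the sup norm, hence this one. *)
Definition euclidean_norm (R : realType) (n : nat) (x : 'rV[R]_n) : R :=
  Num.sqrt (\sum_(i < n) x ord0 i ^+ 2).

Record simple_graph (T : Type) := SimpleGraph {
  vertices : set T;
  edges : set (set T);
  edgesP : forall e, edges e ->
    exists x y, [/\ vertices x, vertices y, x <> y & e = [set x; y]]
}.

Definition is_distance_graph (R : realType) (n : nat)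
    (G : simple_graph 'rV[R]_n) : Prop :=
  exists2 a : R, 0 < a &
    edges G `<=` [set e | exists x y, [/\ vertices G x, vertices G y,
      euclidean_norm (x - y) = a & e = [set x; y]]].

Definition proper_coloring (T : Type) (G : simple_graph T) (m : nat)
    (c : T -> nat) : Prop :=
  (forall x, vertices G x -> (c x < m)%N) /\
  (forall x y, edges G [set x; y] -> c x <> c y).

(* Graphs may be infinite; the value is +oo when no finite number of colors
   suffices. *)
Definition chromatic_number (R : realType) (T : Type) (G : simple_graph T) :
    \bar R :=
  ereal_inf [set m%:R%:E | m in [set m : nat | exists c, proper_coloring G m c]].

Definition is_clique (T : choiceType) (G : simple_graph T) (A : {fset T}) :
    Prop :=
  (forall x, x \in A -> vertices G x) /\
  (forall x y, x \in A -> y \in A -> x <> y -> edges G [set x; y]).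

(* The value is +oo when G has arbitrarily large finite cliques. *)
Definition clique_number (R : realType) (T : choiceType) (G : simple_graph T) :
    \bar R :=
  ereal_sup [set (#|` A|)%:R%:E | A in [set A : {fset T} | is_clique G A]].

Definition clique_admissible (R : realType) (k : int) (zeta : R) : Prop :=
  exists2 delta : nat -> R, delta n @[n --> \oo] --> (0 : R) &
    forall n : nat, (0 < n)%N ->
      exists G : simple_graph 'rV[R]_n,
        [/\ is_distance_graph G,
            (clique_number R G < (k%:~R : R)%:E)%E &
            (((zeta + delta n) ^+ n)%:E <= chromatic_number R G)%E].

(* The supremum is taken in the extended reals, where it always exists. *)
Definition zeta_clique (R : realType) (k : int) : \bar R :=
  ereal_sup [set zeta%:E | zeta in [set zeta : R | clique_admissible k zeta]].

(* Main.v *)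
(* The main point is that triangles cost nothing: if a finite distance graph H
   in R^d (d even) is not m-colorable, then R^d contains a triangle-free
   distance graph that is not m-colorable either. Take the Cartesian power H^M,
   in which every line is a copy of H, and keep a single edge in each line.
   Triangles of H^M lie in lines, so none survives. A fixed m-coloring of the
   vertices has a monochromatic edge in every line, so a random choice of edges
   avoids all of these with probability at most ((r - 1) / r)^(M N^(M - 1)),
   where H has N vertices and r edges, and for M large this beats the number
   m^(N^M) of colorings. Finally H^M embeds in R^d as the Minkowski sum of M
   generic rotations of H.

   Hence H may be any graph with large chromatic number. Here it is the
   Frankl-Wilson graph of the (2q-1)-subsets of a 4q-set meeting in q-1 points,
   with q a power of 2, so that nothing about the distribution of primes is
   needed: although 4q may be as small as n / 2, the chromatic number is at
   least (5/2)^(q/2) > (32/27)^(8q/3) >= (2 * (1/3)^(1/3) * (2/3)^(2/3))^n. *)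

Require Import Defs.
From mathcomp Require Import all_boot all_order all_algebra finmap.
From mathcomp Require Import all_classical all_reals all_analysis.
From mathcomp Require Import zify ring lra.

Set Implicit Arguments.
Unset Strict Implicit.
Unset Printing Implicit Defensive.

Import Order.TTheory GRing.Theory Num.Theory.
Import numFieldNormedType.Exports.

Local Open Scope ring_scope.

(** * The Frankl-Wilson bound modulo a power of 2 *)

(** In Vandermonde's sum only the first term can be odd: [2^k] divides [i * 'C(2^k, i)], so an odd
    ['C(2^k, i)] with [0 < i] would force [2^k <= i]. *)
Lemma odd_bin_pow2D (k r j : nat) :
  (j < 2 ^ k)%N -> odd 'C(2 ^ k + r, j) = odd 'C(r, j).
Proof.
move=> ltj; rewrite -binomial.Vandermonde big_ord_recl subn0 bin0 mul1n oddD.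
suff -> : odd (\sum_(i < j) 'C(2 ^ k, bump 0 i) * 'C(r, j - bump 0 i)) = false.
  by rewrite addbF.
rewrite (big_morph odd oddD (erefl _)) big1 // => i _; rewrite oddM.
have lti : (i.+1 < 2 ^ k)%N by rewrite (leq_ltn_trans _ ltj).
suff /negbTE-> : ~~ odd 'C(2 ^ k, i.+1) by [].
apply/negP => o; have: (2 ^ k %| i.+1 * 'C(2 ^ k, i.+1))%N.
  by rewrite -mul_bin_diag dvdn_mulr.
rewrite Gauss_dvdl; last by rewrite coprimeXl // coprime2n.
by move/dvdn_leq => /(_ isT); rewrite leqNgt lti.
Qed.

(* The inclusion matrix between F and the (2^k - 1)-subsets has Gram matrix 1
   over F_2, because 'C(l, 2^k - 1) is odd exactly when l = -1 mod 2^k. *)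
Lemma Frankl_Wilson_pow2 (n k : nat) (F : {set {set 'I_n}}) :
  (forall A, A \in F -> #|A| = (2 ^ k).*2.-1) ->
  (forall A B, A \in F -> B \in F -> #|A :&: B| <> (2 ^ k).-1) ->
  (#|F| <= 'C(n, (2 ^ k).-1))%N.
Proof.
set q := (2 ^ k)%N => cardF interF; have q_gt0 : (0 < q)%N by rewrite expn_gt0.
pose D := [set X : {set 'I_n} | #|X| == q.-1].
have <- : #|D| = 'C(n, q.-1) by rewrite card_draws card_ord.
pose M := \matrix_(i < #|F|, j < #|D|)
  ((enum_val j \subset enum_val i)%:R : 'F_2).
suff MM : M *m M^T = 1%:M.
  by rewrite -(mxrank1 'F_2 #|F|) -MM
    (leq_trans (mxrankM_maxl _ _)) ?rank_leq_col.
apply/matrixP => i j; rewrite !mxE.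
set A := enum_val i; set B := enum_val j.
have AF : A \in F by apply: enum_valP.
have BF : B \in F by apply: enum_valP.
transitivity (\sum_(X in D) ((X \subset A) && (X \subset B))%:R : 'F_2).
  rewrite [RHS]big_enum_val; apply: eq_bigr => l _.
  by rewrite !mxE -natrM mulnb.
transitivity (('C(#|A :&: B|, q.-1))%:R : 'F_2).
  rewrite -cards_draws -sum1_card natr_sum big_mkcond [RHS]big_mkcond /=.
  apply: eq_bigr => X _; rewrite !inE finset.subsetI.
  by case: eqP; case: (X \subset A); case: (X \subset B).
have odd_natr (l : nat) : (l%:R : 'F_2) = (odd l)%:R.
  rewrite -[l in LHS]odd_double_half -muln2 natrD natrM.
  by rewrite (_ : 2%:R = 0 :> 'F_2) ?mulr0 ?addr0 //; apply/val_inj.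
rewrite odd_natr; congr (_%:R); have [eq_ij|neq_ij] := eqVneq i j.
  rewrite /B -eq_ij -/A finset.setIid cardF // -/q.
  have -> : (q.*2.-1 = q + q.-1)%N by lia.
  by rewrite odd_bin_pow2D ?binn // -/q; lia.
have AB : A != B by rewrite (inj_eq enum_val_inj).
have : (#|A :&: B| < q.*2.-1)%N.
  rewrite -(cardF _ AF) proper_card // finset.properEneq finset.subsetIl andbT.
  apply: contra AB => /eqP AIB; rewrite eqEcard (cardF _ AF) (cardF _ BF) leqnn.
  by rewrite -AIB finset.subsetIr.
(* Here [l < 2q - 1] and [l <> q - 1]. If [q <= l], the parity is that of ['C(l - q, q - 1)] with
   [l - q < q - 1]; otherwise [l < q - 1]. Either way the binomial vanishes. *)
have := interF _ _ AF BF; set l := #|_| => lq ltl.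
have [leq_ql|ltlq] := leqP q l; last by rewrite bin_small //; lia.
rewrite -(subnKC leq_ql) odd_bin_pow2D -/q; last by lia.
by rewrite bin_small //; lia.
Qed.

(** The quotient of the two binomials is the product of [(4h + 2 + i) / (2h + i)] over [i < 2h]. Its
    factors are at least 5/3 for [i < h] and at least 3/2 afterwards, and 5/3 * 3/2 = 5/2. *)
Lemma bin_ratio_lower_bound (h : nat) : (0 < h)%N ->
  (5 ^ h * 'C(8 * h, (2 * h).-1) <= 2 ^ h * 'C(8 * h, (4 * h).-1))%N.
Proof.
move=> h_gt0.
have factD x k : ((x + k)`! = x`! * \prod_(i < k) (x.+1 + i))%N.
  elim: k => [|k IH]; first by rewrite big_ord0 addn0 muln1.
  by rewrite addnS factS IH big_ord_recr /= addSn [RHS]mulnA [RHS]mulnC.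
have E1 := factD (2 * h).-1 (2 * h)%N; have E2 := factD (4 * h).+1 (2 * h)%N.
have F1 : ((4 * h).-1 <= 8 * h)%N by lia.
have F2 : ((2 * h).-1 <= 8 * h)%N by lia.
move: (bin_fact F1) (bin_fact F2) => {F1 F2}.
have -> : (8 * h - (4 * h).-1 = (4 * h).+1)%N by lia.
have -> : (8 * h - (2 * h).-1 = (4 * h).+1 + 2 * h)%N by lia.
have e1 : ((4 * h).-1 = (2 * h).-1 + 2 * h)%N by lia.
rewrite {2}e1 E1 E2 => F1 F2.
set P1 := (\prod_(_ < _) _)%N in F1; set P2 := (\prod_(_ < _) _)%N in F2.
suff PP : (5 ^ h * P1 <= 2 ^ h * P2)%N.
  have g1 := fact_gt0 (2 * h).-1; have g2 := fact_gt0 (4 * h).+1.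
  have P1_gt0 : (0 < P1)%N by apply: prodn_gt0.
  set X := 'C(_, _) in F1 *; set Y := 'C(_, _) in F2 *.
  have XY : (X * P1 = Y * P2)%N.
    apply/eqP; rewrite -(eqn_pmul2r g1) -(eqn_pmul2r g2); apply/eqP; nia.
  rewrite -(leq_pmul2r P1_gt0) -[leqRHS]mulnA XY; nia.
have split2 (f : nat -> nat) : (\prod_(i < 2 * h) f i =
    (\prod_(i < h) f i) * \prod_(i < h) f (h + i))%N.
  by rewrite mul2n -addnn big_split_ord.
rewrite /P1 /P2 (split2 (fun i => _ + i)%N) (split2 (fun i => (_).+2 + i)%N).
have powM c (f : nat -> nat) :
    (c ^ h * \prod_(i < h) f i = \prod_(i < h) (c * f i))%N.
  by rewrite big_split prod_nat_const card_ord.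
have L1 : (5 ^ h * \prod_(i < h) ((2 * h).-1.+1 + i) <=
    3 ^ h * \prod_(i < h) ((4 * h).+2 + i))%N.
  rewrite (powM _ (fun i => _ + i)%N) (powM _ (fun i => (_).+2 + i)%N).
  by apply: leq_prod => i _; have := ltn_ord i; lia.
have L2 : (3 ^ h * \prod_(i < h) ((2 * h).-1.+1 + (h + i)) <=
    2 ^ h * \prod_(i < h) ((4 * h).+2 + (h + i)))%N.
  rewrite (powM _ (fun i => _ + (h + i))%N)
    (powM _ (fun i => (_).+2 + (h + i))%N).
  by apply: leq_prod => i _; have := ltn_ord i; lia.
have : (0 < 3 ^ h)%N by rewrite expn_gt0.
have := leq_mul L1 L2.
set a := (5 ^ h)%N; set b := (3 ^ h)%N; set c := (2 ^ h)%N.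
set A := bigop _ _ _; set B := bigop _ _ _.
set C := bigop _ _ _; set D := bigop _ _ _.
by move=> H b0; rewrite -(leq_pmul2l b0); nia.
Qed.

(** * Random choice of one edge in each line *)

(* y lists the coordinates other than the j-th. *)
Definition line_point (T : finType) (P : nat)
    (j : 'I_P.+1) (y : {ffun 'I_P -> T}) (z : T) :
  {ffun 'I_P.+1 -> T} := [ffun i => if unlift j i is Some k then y k else z].

(** [D] indexes the edges of a graph on [T], with ends given by [s] and [t]; [f] selects the edge
    kept in each line. *)
Lemma exists_line_edges (T D : finType) (s t : D -> T) (m : nat) :
  (0 < m)%N ->
  (forall c : T -> 'I_m, exists d, c (s d) = c (t d)) ->
  exists P (f : 'I_P.+1 -> {ffun 'I_P -> T} -> D),
    forall c : {ffun 'I_P.+1 -> T} -> 'I_m, exists j y,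
      c (line_point j y (s (f j y))) = c (line_point j y (t (f j y))).
Proof.
move=> m_gt0 mono; have [d0 _] := mono (fun=> Ordinal m_gt0).
have r_gt0 : (0 < #|D|)%N by apply/card_gt0P; exists d0.
have N_gt0 : (0 < #|T|)%N by apply/card_gt0P; exists (s d0).
set r := #|D| in r_gt0; set N := #|T| in N_gt0.
(* After an [N^P]-th root, the union bound over colorings needs [m^N * (r-1)^(P+1) < r^(P+1)], which
   Bernoulli's inequality ([bern]) gives for this [P]. *)
pose P := (m ^ N * r)%N.
pose key := ('I_P.+1 * {ffun 'I_P -> T})%type.
pose pts := {ffun 'I_P.+1 -> T}.
(* A selection is bad when, for some coloring [c], every kept edge has ends of different colors. *)
pose avoid (c : {ffun pts -> 'I_m}) (k : key) : pred D :=
  [pred d | c (line_point k.1 k.2 (s d)) != c (line_point k.1 k.2 (t d))].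
pose bad := [set f : {ffun key -> D} | [exists c, f \in family (avoid c)]].
suff [f fP] : exists f, f \notin bad.
  exists P, (fun j y => f (j, y)) => c; move: fP.
  rewrite inE => /existsPn/(_ (finfun c)).
  move=> /familyP nf; apply/not_existsP => nj; apply: nf => -[j y] /=.
  rewrite inE /= !ffunE; apply/eqP => e; apply: (nj j); by exists y.
suff : (#|bad| < #|{ffun key -> D}|)%N.
  move=> lt; case: (pickP [predC bad]) => [f fP|all_bad]; first by exists f.
  move: lt; rewrite (eq_card (_ : bad =i predT)) ?ltnn // => f.
  by have := all_bad f; rewrite /= => /negbFE.
have card_avoid c k : (#|avoid c k| <= r.-1)%N.
  have [d /= e] := mono (fun z => c (line_point k.1 k.2 z)).
  have : (#|avoid c k| < r)%N.
    apply: proper_card; apply/properP; split.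
      exact/fintype.subsetP.
    by exists d; rewrite // inE e eqxx.
  lia.
apply: (@leq_ltn_trans (\sum_(c : {ffun pts -> 'I_m}) r.-1 ^ #|{: key}|)).
  apply: (@leq_trans #|\bigcup_(c : {ffun pts -> 'I_m})
      [set f : {ffun key -> D} | f \in family (avoid c)]|).
    apply: subset_leq_card; apply/fintype.subsetP => f.
    rewrite inE => /existsP[c fc].
    by apply/bigcupP; exists c; rewrite // inE.
  apply: (leq_trans (unstable.card_big_setU _ _ _)); apply: leq_sum => c _.
  rewrite cardsE card_family foldrE big_image /= -prod_nat_const.
  by apply: leq_prod => k _; apply: card_avoid.
rewrite sum_nat_const !card_ffun card_prod !card_ffun !card_ord -/N -/r.
rewrite expnS !expnM -expnMn ltn_exp2r ?expn_gt0 ?N_gt0 //.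
have bern k : (r.-1 ^ k * (r.-1 + k.+1) <= r ^ k.+1)%N.
  elim: k => [|k IH]; first by rewrite expn0 expn1; lia.
  rewrite (expnS r k.+1); apply: leq_trans (leq_mul (leqnn r) IH).
  by rewrite -{3}(prednK r_gt0) expnS; nia.
case: (posnP r.-1) => [->|r1_gt0]; first by rewrite exp0n // muln0 expn_gt0 r_gt0.
apply: leq_trans (bern P).
rewrite expnSr mulnCA ltn_pmul2l ?expn_gt0 ?r1_gt0 // /P.
by have := expn_gt0 m N; rewrite m_gt0; nia.
Qed.

(** * Embedding Cartesian powers by generic rotations *)

Section Embedding.
Variable R : realType.

Lemma euclidean_norm_mulmx n (u : 'rV[R]_n) :
  euclidean_norm u = Num.sqrt ((u *m u^T) 0 0).
Proof. by rewrite mxE; congr Num.sqrt; apply: eq_bigr => i _; rewrite mxE. Qed.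

(** Multiplication by the complex number [c + i s], with [R^(d + d)] read as [C^d]. This is where
    even dimension enters. *)
Definition similarity_mx d (c s : R) : 'M[R]_(d + d) :=
  block_mx c%:M s%:M (- s)%:M c%:M.

Lemma similarity_mxB d c s c' s' :
  similarity_mx d c s - similarity_mx d c' s' =
  similarity_mx d (c - c') (s - s').
Proof.
by rewrite /similarity_mx opp_block_mx add_block_mx opprD !raddfD !raddfN.
Qed.

Lemma similarity_mxM_tr d c s :
  similarity_mx d c s *m (similarity_mx d c s)^T = (c ^+ 2 + s ^+ 2)%:M.
Proof.
rewrite /similarity_mx tr_block_mx !tr_scalar_mx mulmx_block -!scalar_mxM /=.
rewrite (scalar_mx_block d d (c ^+ 2 + s ^+ 2)).
have addM (a b x : R) : a + b = x -> a%:M + b%:M = x%:M :> 'M[R]_d.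
  by move=> <-; rewrite raddfD.
have addM0 (a b : R) : a + b = 0 -> a%:M + b%:M = 0 :> 'M[R]_d.
  by move/addM->; rewrite raddf0.
by congr block_mx;
  [apply: addM | apply: addM0 | apply: addM0 | apply: addM]; ring.
Qed.

(** The rational parametrization of the unit circle: the angle is [2 arctan t]. *)
Definition rotation_mx d (t : nat) : 'M[R]_(d + d) :=
  similarity_mx d ((1 - t%:R ^+ 2) / (1 + t%:R ^+ 2))
    (2 * t%:R / (1 + t%:R ^+ 2)).

Lemma euclidean_norm_rotation d t (u : 'rV[R]_(d + d)) :
  euclidean_norm (u *m rotation_mx d t) = euclidean_norm u.
Proof.
rewrite !euclidean_norm_mulmx trmx_mul mulmxA -(mulmxA u) similarity_mxM_tr.
have nz : 1 + t%:R ^+ 2 != 0 :> R by have := sqr_ge0 (t%:R : R); lra.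
rewrite (_ : _ ^+ 2 + _ = 1) ?mulmx1 //.
by field.
Qed.

(** The difference of two such rotations is again a complex multiplication, so it kills a nonzero
    vector only if it is zero. Then the cosines agree, and they determine [t >= 0]. *)
Lemma rotation_mx_free d t t' (u : 'rV[R]_(d + d)) :
  u *m rotation_mx d t = u *m rotation_mx d t' -> u != 0 -> t = t'.
Proof.
move=> /eqP; rewrite -subr_eq0 -mulmxBr => /eqP ut u0.
move: ut; rewrite /rotation_mx similarity_mxB.
set c := (_ - _); set s := (_ - _) => ut.
have : u *m (similarity_mx d c s *m (similarity_mx d c s)^T) = 0.
  by rewrite mulmxA ut mul0mx.
rewrite similarity_mxM_tr mul_mx_scalar => /eqP; rewrite scaler_eq0 (negPf u0) orbF.
rewrite paddr_eq0 ?sqr_ge0 // !sqrf_eq0 => /andP[+ _]; rewrite /c subr_eq0.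
have p (k : nat) : 1 + k%:R ^+ 2 != 0 :> R by have := sqr_ge0 (k%:R : R); lra.
rewrite eqr_div // => /eqP e.
have : (t%:R ^+ 2 = t'%:R ^+ 2 :> R) by lra.
by move=> /eqP; rewrite eqrXn2 ?ler0n // eqr_nat => /eqP.
Qed.

(* Each coincidence of sums rules out at most one rotation parameter, so among
   finitely many possible coincidences some parameter is free of all. *)
Lemma generic_sum_inj (T : finType) d (v : T -> 'rV[R]_(d + d)) : injective v ->
  forall M : nat, exists t : nat -> nat, forall x y : nat -> T,
    \sum_(j < M) v (x j) *m rotation_mx d (t j) =
    \sum_(j < M) v (y j) *m rotation_mx d (t j) ->
    forall j, (j < M)%N -> x j = y j.
Proof.
move=> v_inj; elim=> [|M [t tP]]; first by exists id.
pose S (x : {ffun 'I_M -> T}) := \sum_(j < M) v (x j) *m rotation_mx d (t j).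
pose K := ({ffun 'I_M -> T} * {ffun 'I_M -> T} * T * T)%type.
pose hit (k : nat) (q : K) := (q.1.2 != q.2) &&
  (S q.1.1.1 + v q.1.2 *m rotation_mx d k ==
   S q.1.1.2 + v q.2 *m rotation_mx d k).
have [k kP] : exists k, forall q, ~~ hit k q.
  apply/not_existsP => nk.
  have /choice[q qP] : forall k, exists q, hit k q.
    by move=> k; apply/not_existsP => nq; apply: (nk k) => q; apply/negP/nq.
  (* Pigeonhole: were every parameter hit, two of the first [#|K| + 1] would share a coincidence,
     contrary to [rotation_mx_free]. *)
  suff q_inj : injective (fun k : 'I_#|{: K}|.+1 => q k).
    by have := leq_card _ q_inj; rewrite card_ord ltnn.
  move=> k k' qk; apply: val_inj => /=; move: (qP k) (qP k'); rewrite /hit -qk.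
  case: (q k) => -[[x y] a] b /= /andP[ab /eqP e] /andP[_ /eqP e'].
  apply: (@rotation_mx_free d _ _ (v a - v b)); last first.
    by rewrite subr_eq0 (inj_eq v_inj).
  rewrite !mulmxBl; move: e e'.
  set A := v a *m rotation_mx d k; set B := v b *m rotation_mx d k.
  set A' := v a *m _; set B' := v b *m _ => e e'.
  have -> : A - B = S y - S x.
    by apply/eqP; rewrite subr_eq addrAC -e [S x + A]addrC addrK.
  by apply/esym/eqP; rewrite subr_eq addrAC -e' [S x + A']addrC addrK.
exists (fun j => if (j < M)%N then t j else k) => x y.
rewrite !big_ord_recr /= ltnn.
have restr z :
    \sum_(i < M) v (z i) *m rotation_mx d (if (i < M)%N then t i else k) =
    S [ffun i : 'I_M => z i].
  by apply: eq_bigr => i _; rewrite ltn_ord ffunE.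
rewrite !restr => e.
have xy : x M = y M.
  apply/eqP; apply: contraT => nxy.
  have := kP ([ffun i : 'I_M => x i], [ffun i : 'I_M => y i], x M, y M).
  by rewrite /hit /= nxy e eqxx.
move=> j; rewrite ltnS leq_eqVlt => /orP[/eqP-> //|]; apply: tP.
move: e; rewrite xy => /addIr; rewrite /S.
by under eq_bigr do rewrite ffunE; under [RHS]eq_bigr do rewrite ffunE.
Qed.

(** Points that differ only in coordinate [j] have images differing by one rotated vector, and
    rotations keep norms. The [e] zero coordinates pad to an arbitrary dimension. *)
Lemma cartesian_power_embedding (T : finType) d e
    (v : T -> 'rV[R]_(d + d)) (z0 : T) (M : nat) :
  injective v ->
  exists Phi : {ffun 'I_M -> T} -> 'rV[R]_(d + d + e),
    injective Phi /\
    forall (x y : {ffun 'I_M -> T}) (j : 'I_M),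
      (forall i, i != j -> x i = y i) ->
      euclidean_norm (Phi x - Phi y) = euclidean_norm (v (x j) - v (y j)).
Proof.
move=> v_inj; have [t tP] := generic_sum_inj v_inj M.
pose S (x : {ffun 'I_M -> T}) := \sum_(j < M) v (x j) *m rotation_mx d (t j).
exists (fun x => row_mx (S x) 0); split.
  move=> x y /eq_row_mx[Sxy _]; apply/ffunP => j.
  (* [z0] is only a default value for indices from [M] on. *)
  pose ext (z : {ffun 'I_M -> T}) (i : nat) :=
    if insub i is Some k then z k else z0.
  have extE z (i : 'I_M) : ext z i = z i by rewrite /ext valK.
  have := tP (ext x) (ext y) _ j (ltn_ord j); rewrite !extE; apply.
  by under eq_bigr do rewrite extE; under [RHS]eq_bigr do rewrite extE.
move=> x y j xy; rewrite opp_row_mx add_row_mx subrr.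
have -> : S x - S y = (v (x j) - v (y j)) *m rotation_mx d (t j).
  rewrite /S -sumrB (bigD1 j) //= big1 ?addr0 ?mulmxBl // => i ij.
  by rewrite xy // subrr.
rewrite -[RHS](euclidean_norm_rotation (t j)) !euclidean_norm_mulmx.
by rewrite tr_row_mx mul_row_col trmx0 mulmx0 addr0.
Qed.
End Embedding.

(** * Triangle-freeness *)

Section LineEdges.
Variables (T D : finType) (s t : D -> T) (P : nat).
Variable f : 'I_P.+1 -> {ffun 'I_P -> T} -> D.

Lemma line_point_at (j : 'I_P.+1) (y : {ffun 'I_P -> T}) z :
  line_point j y z j = z.
Proof. by rewrite ffunE unlift_none. Qed.

Lemma line_point_off (j : 'I_P.+1) (y : {ffun 'I_P -> T}) z z' i :
  i != j -> line_point j y z i = line_point j y z' i.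
Proof.
by move=> ij; rewrite !ffunE; case: unliftP ij => // ->; rewrite eqxx.
Qed.

Lemma line_point_base_inj (j : 'I_P.+1) (y y' : {ffun 'I_P -> T}) z z' :
  line_point j y z = line_point j y' z' -> y = y'.
Proof.
move=> e; apply/ffunP => k.
have := congr1 (fun x : {ffun _ -> _} => x (lift j k)) e.
by rewrite !ffunE liftK.
Qed.

Definition line_edge (x y : {ffun 'I_P.+1 -> T}) : Prop :=
  exists j w,
    let S := line_point j w (s (f j w)) in
    let S' := line_point j w (t (f j w)) in
    (x = S /\ y = S') \/ (x = S' /\ y = S).

(** The ends of an edge differ in one coordinate only. If two sides of a triangle had different
    directions, the third would have to share both; so all three sides lie in one line, which keeps
    a single edge. *)
Lemma line_edge_triangle_free x y z :
  line_edge x y -> line_edge y z -> line_edge x z ->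
  x <> y -> y <> z -> x <> z -> False.
Proof.
have agree u v j w :
    (u = line_point j w (s (f j w)) /\ v = line_point j w (t (f j w))) \/
    (u = line_point j w (t (f j w)) /\ v = line_point j w (s (f j w))) ->
    forall i, i != j -> u i = v i.
  by case=> -[-> ->] i /line_point_off; apply.
have differ (u v : {ffun 'I_P.+1 -> T}) j :
    (forall i, i != j -> u i = v i) -> u <> v -> u j <> v j.
  by move=> uv nuv uvj; apply: nuv; apply/ffunP => i;
    have [->|/uv] := eqVneq i j.
move=> [j1 [w1 /= e1]] [j2 [w2 /= e2]] [j3 [w3 /= e3]] xy yz xz.
have A1 := agree _ _ _ _ e1; have A2 := agree _ _ _ _ e2.
have A3 := agree _ _ _ _ e3.
have D1 := differ _ _ _ A1 xy; have D2 := differ _ _ _ A2 yz.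
have D3 := differ _ _ _ A3 xz.
have j12 : j1 = j2.
  apply/eqP/negPn/negP => n12.
  have e13 : j1 = j3.
    apply/eqP/negPn/negP => n13; apply: D1; rewrite A3 // A2 //.
  have e23 : j2 = j3.
    apply/eqP/negPn/negP => n23; apply: D2; rewrite -A3 // A1 // eq_sym //.
  by move: n12; rewrite e13 e23 eqxx.
have j13 : j3 = j1.
  by apply/eqP/negPn/negP => n31; apply: D3; rewrite A1 // A2 // -j12.
subst j2 j3.
have w12 : w1 = w2 by case: e1 e2 => -[_ ->] [] [/line_point_base_inj].
subst w2.
have w13 : w1 = w3 by case: e1 e3 => -[-> _] [] [/line_point_base_inj].
by subst w3; case: e1 e2 e3 => -[? ?] [] [? ?] [] [? ?]; congruence.
Qed.

End LineEdges.

(** * From a non-colorable graph to a triangle-free distance graph *)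

Lemma set2_eq (T : Type) (x y x' y' : T) :
  ([set x; y] = [set x'; y'])%classic ->
  (x = x' /\ y = y') \/ (x = y' /\ y = x').
Proof.
move=> e.
have : [set x'; y']%classic x by rewrite -e; left.
have : [set x'; y']%classic y by rewrite -e; right.
have : [set x; y]%classic x' by rewrite e; left.
have : [set x; y]%classic y' by rewrite e; right.
by move=> [] -> [] -> [] ? [] ?; subst; auto.
Qed.

Lemma triangle_free_distance_graph (R : realType) (T D : finType)
    (s t : D -> T) d e (v : T -> 'rV[R]_(d + d)) (a : R) (m : nat) :
  (0 < m)%N -> 0 < a -> injective v ->
  (forall i, euclidean_norm (v (s i) - v (t i)) = a) ->
  (forall c : T -> 'I_m, exists i, c (s i) = c (t i)) ->
  exists G : simple_graph 'rV[R]_(d + d + e),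
    [/\ is_distance_graph G, (clique_number R G <= 2%:E)%E &
        (m.+1%:R%:E <= chromatic_number R G)%E].
Proof.
move=> m_gt0 a_gt0 v_inj dist mono.
have st i : s i <> t i.
  move=> si; have := dist i.
  rewrite si subrr euclidean_norm_mulmx mul0mx mxE sqrtr0.
  by move=> a0; rewrite a0 ltxx in a_gt0.
have [P [f fP]] := exists_line_edges m_gt0 mono.
have [i0 _] := mono (fun=> Ordinal m_gt0).
have [Phi [Phi_inj PhiP]] := cartesian_power_embedding e (s i0) P.+1 v_inj.
pose src j w := line_point j w (s (f j w)).
pose tgt j w := line_point j w (t (f j w)).
have src_tgt j w : src j w <> tgt j w.
  move=> /(congr1 (fun x : {ffun _ -> _} => x j)).
  by rewrite /src /tgt !line_point_at => /st.
pose V := range Phi.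
pose E := [set S | exists j w, S = [set Phi (src j w); Phi (tgt j w)]]%classic.
have EP S : E S -> exists x y, [/\ V x, V y, x <> y & S = [set x; y]%classic].
  move=> [j [w ->]]; exists (Phi (src j w)), (Phi (tgt j w)).
  by split=> //; [exists (src j w)|exists (tgt j w)|move=> /Phi_inj/src_tgt].
exists (SimpleGraph EP); split.
- exists a => // S [j [w ->]]; exists (Phi (src j w)), (Phi (tgt j w)).
  split=> //; [by exists (src j w)|by exists (tgt j w)|].
  rewrite (PhiP _ _ j) /src /tgt ?line_point_at //.
  exact: line_point_off.
- apply: ge_ereal_sup => _ [A [Av Ae] <-].
  rewrite lee_fin ler_nat leqNgt; apply/negP => A3.
  have [x [y [z [xA yA zA [xy yz xz]]]]] : exists x y z,
      [/\ x \in A, y \in A, z \in A & [/\ x <> y, y <> z & x <> z]].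
    case EA : (enum_fset A) (fset_uniq A) A3 => [|x [|y [|z r]]] //= + _.
    rewrite !inE => /and3P[] /norP[/eqP xy /norP[/eqP xz _]] /norP[/eqP yz _] _.
    by exists x, y, z; split=> //;
      rewrite -[_ \in A]/(_ \in enum_fset A) EA !inE eqxx ?orbT.
  have edgeP x' y' : E [set Phi x'; Phi y']%classic -> line_edge s t f x' y'.
    move=> [j [w H]]; exists j, w.
    by case: (set2_eq H) => -[/Phi_inj ? /Phi_inj ?]; [left|right].
  have [x' _ ex] := Av _ xA; have [y' _ ey] := Av _ yA.
  have [z' _ ez] := Av _ zA.
  have Exy := Ae _ _ xA yA xy; have Eyz := Ae _ _ yA zA yz.
  have Exz := Ae _ _ xA zA xz.
  subst x y z.
  by apply: (line_edge_triangle_free (edgeP _ _ Exy) (edgeP _ _ Eyz)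
    (edgeP _ _ Exz)) => ?; subst.
- apply: le_ereal_inf_tmp => _ [k [c [ck cE]] <-].
  rewrite lee_fin ler_nat ltnNge; apply/negP => km.
  (* A proper coloring with [k <= m] colors pulls back along [Phi] to an [m]-coloring of the power,
     which has a monochromatic kept edge. *)
  pose c' x := Ordinal (leq_trans (ck (Phi x) (ex_intro2 _ _ x I erefl)) km).
  have [j [w]] := fP c'; move/(congr1 val) => /=.
  by apply: cE; exists j, w.
Qed.

Lemma euclidean_norm_indicatorB (R : realType) (n : nat) (A B : {set 'I_n}) :
  euclidean_norm (\row_i (i \in A)%:R - \row_i (i \in B)%:R : 'rV[R]_n) =
  Num.sqrt (#|A|%:R + #|B|%:R - 2 * #|A :&: B|%:R).
Proof.
congr Num.sqrt.
have cardE (X : {set 'I_n}) : #|X|%:R = \sum_i (i \in X)%:R :> R.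
  rewrite -sum1_card natr_sum big_mkcond; apply: eq_bigr => i _.
  by case: (i \in X).
rewrite !cardE mulr_sumr -big_split -sumrB /=; apply: eq_bigr => i _.
by rewrite !mxE inE; case: (i \in A); case: (i \in B) => /=; ring.
Qed.

(** * The Frankl-Wilson graph on [4q] points *)

Section JohnsonGraph.
Variables (k : nat).
Let q := (2 ^ k.+1)%N.
Let h := (2 ^ k)%N.

(** The size [4q] is written [q.*2 + q.*2] to match the dimension [d + d] of the rotations. *)
Definition half_subset := {A : {set 'I_(q.*2 + q.*2)} | #|A| == q.*2.-1}.
Definition half_edge :=
  {p : half_subset * half_subset | #|val p.1 :&: val p.2| == q.-1}.

(** A color class without edges has at most ['C(4q, q - 1)] members by Frankl-Wilson, and
    [m < (5/2)^h] such classes cannot cover all ['C(4q, 2q - 1)] vertices. *)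
Lemma half_subset_mono (m : nat) (c : half_subset -> 'I_m) :
  (m * 2 ^ h < 5 ^ h)%N ->
  exists p : half_edge, c (val p).1 = c (val p).2.
Proof.
move=> mh; apply/not_existsP => nmono.
pose cls i := [set val x | x in [set x | c x == i]]%SET.
have le_cls i : (#|cls i| <= 'C(q.*2 + q.*2, q.-1))%N.
  apply: Frankl_Wilson_pow2 =>
    [_ /imsetP[x _ ->]|_ _ /imsetP[x + ->] /imsetP[y + ->]].
    exact/eqP/(valP x).
  rewrite !inE => /eqP cx /eqP cy /eqP xy; apply: (nmono (exist _ (x, y) xy)).
  by rewrite /= cx cy.
have cardT : #|{: half_subset}| = 'C(q.*2 + q.*2, q.*2.-1).
  rewrite card_sig; have := card_draws 'I_(q.*2 + q.*2) q.*2.-1.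
  by rewrite card_ord cardsE.
have : ('C(q.*2 + q.*2, q.*2.-1) <= m * 'C(q.*2 + q.*2, q.-1))%N.
  rewrite -cardT -{1}(card_ord m) -sum_nat_const -sum1_card.
  rewrite (partition_big c xpredT) //=.
  apply: leq_sum => i _; apply: leq_trans (le_cls i).
  by rewrite card_imset ?cardsE ?sum1_card //; exact: val_inj.
have h_gt0 : (0 < h)%N by rewrite expn_gt0.
have qh : q = (2 * h)%N by rewrite /q expnS.
have := bin_ratio_lower_bound h_gt0.
rewrite (_ : q.*2 + q.*2 = 8 * h)%N; last by lia.
rewrite (_ : q.*2.-1 = (4 * h).-1)%N; last by lia.
rewrite -qh.
have : (0 < 'C(8 * h, q.-1))%N by rewrite bin_gt0; lia.
set X := 'C(_, _); set Y := 'C(_, _); move: mh.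
by set a := (2 ^ h)%N; set b := (5 ^ h)%N; nia.
Qed.

End JohnsonGraph.

(** * Numerical estimates of the constant *)

Section Constant.
Variable R : realType.
Let z : R := 2 * (1 / 3) `^ (1 / 3) * (2 / 3) `^ (2 / 3).

Lemma zeta3_ge0 : 0 <= z.
Proof. by rewrite !mulr_ge0 ?powR_ge0. Qed.

Lemma zeta3_cubed : z ^+ 3 = 32 / 27.
Proof.
rewrite /z !exprMn -!(powR_mulrn 3 (powR_ge0 _ _)) -!powRrM.
rewrite (_ : 1 / 3 * 3%:R = 1); last by lra.
rewrite (_ : 2 / 3 * 3%:R = 2%:R); last by lra.
by rewrite powRr1 ?powR_mulrn; lra.
Qed.

Lemma zeta3_bounds : 1058 / 1000 <= z < 1059 / 1000.
Proof.
have z0 := zeta3_ge0.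
have lb0 : 0 <= 1058 / 1000 :> R by lra.
have ub0 : 0 <= 1059 / 1000 :> R by lra.
rewrite -(@ler_pXn2r R 3 isT _ _ lb0 z0).
rewrite -(@ltr_pXn2r R 3 isT _ _ z0 ub0) zeta3_cubed.
by rewrite !exprS expr0; apply/andP; split; lra.
Qed.

(** Cubing turns this into [(32/27)^16 <= (5/2)^3]. The exponent 16 comes from [n < 8q = 16h]. *)
Lemma zeta3_expn16 : z ^+ 16 <= 5 / 2.
Proof.
have z16_0 : 0 <= z ^+ 16 by rewrite exprn_ge0 ?zeta3_ge0.
have ub0 : 0 <= 5 / 2 :> R by lra.
rewrite -(@ler_pXn2r R 3 isT _ _ z16_0 ub0) exprAC zeta3_cubed.
rewrite !exprS !expr0; lra.
Qed.
End Constant.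

(** * Choice of parameters and conclusion *)

Lemma triangle_free_large_chromatic (R : realType) (n : nat) : (8 <= n)%N ->
  exists G : simple_graph 'rV[R]_n,
    [/\ is_distance_graph G, (clique_number R G <= 2%:E)%E &
        (((2 * (1 / 3 : R) `^ (1 / 3) * (2 / 3) `^ (2 / 3)) ^+ n)%:E
          <= chromatic_number R G)%E].
Proof.
(* With [q = 2^(k+1)] this gives [4q <= n < 8q]; the remaining [e = n - 4q] dimensions are
   padding. *)
set z := (_ * _) => n8; pose k := (trunc_log 2 n - 3)%N.
have l3 : (3 <= trunc_log 2 n)%N by apply: trunc_log_max.
have kE : trunc_log 2 n = k.+3 by rewrite /k; lia.
have : (2 ^ k.+3 <= n < 2 ^ k.+4)%N.
  by rewrite -kE; apply: trunc_log_bounds => //; apply: leq_trans n8.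
rewrite !(expnS 2 k.+3) !(expnS 2 k.+2) !(expnS 2 k.+1).
set q := (2 ^ k.+1)%N => /andP[le_n lt_n].
have [e nE] : exists e, n = (q.*2 + q.*2 + e)%N.
  by exists (n - (q.*2 + q.*2))%N; lia.
have lt_n16 : (n <= 16 * 2 ^ k)%N by move: lt_n; rewrite /q (expnS 2 k); lia.
move: k kE @q nE le_n lt_n lt_n16 => k _ q nE _ _ lt_n16; subst n.
pose h := (2 ^ k)%N; have h_gt0 : (0 < h)%N by rewrite expn_gt0.
have pow2_gt0 : (0 < 2 ^ h)%N by rewrite expn_gt0.
(* The largest [m] with [m < (5/2)^h], so that [m + 1 >= (5/2)^h]. *)
pose m := ((5 ^ h).-1 %/ 2 ^ h)%N.
have m_lt : (m * 2 ^ h < 5 ^ h)%N.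
  have := leq_divM (5 ^ h).-1 (2 ^ h); rewrite -/m.
  by have := expn_gt0 5 h; lia.
have m_ge : (5 ^ h <= m.+1 * 2 ^ h)%N.
  have := ltn_ceil (5 ^ h).-1 pow2_gt0; rewrite -/m; lia.
have m_gt0 : (0 < m)%N.
  rewrite divn_gt0 //; have : (2 ^ h < 5 ^ h)%N by rewrite ltn_exp2r.
  lia.
pose v (A : half_subset k) : 'rV[R]_(q.*2 + q.*2) := \row_i (i \in val A)%:R.
have v_inj : injective v.
  move=> A B /rowP AB; apply/val_inj/finset.setP => i.
  have := AB i; rewrite !mxE.
  by case: (i \in _); case: (i \in _) => // /eqP;
    rewrite ?oner_eq0 // eq_sym oner_eq0.
have q_gt0 : (0 < q)%N by rewrite expn_gt0.
have a_gt0 : 0 < Num.sqrt (q.*2%:R : R) by rewrite sqrtr_gt0 ltr0n; lia.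
(* The squared length of an edge is [2(2q - 1) - 2(q - 1) = 2q]. *)
have dist (p : half_edge k) :
    euclidean_norm (v (val p).1 - v (val p).2) = Num.sqrt (q.*2%:R : R).
  rewrite euclidean_norm_indicatorB (eqP (valP p)).
  rewrite (eqP (valP (val p).1)) (eqP (valP (val p).2)).
  congr Num.sqrt; rewrite -/q; case: (q) q_gt0 => // r _.
  by rewrite doubleS /= -addnn !mulrS !natrD; ring.
have [G [Gd Gw Gx]] := triangle_free_distance_graph e m_gt0 a_gt0 v_inj dist
  (fun c => half_subset_mono c m_lt).
exists G; split=> //; apply: le_trans Gx; rewrite lee_fin.
have [z_lb _] := andP (zeta3_bounds R); rewrite -/z in z_lb.
have z_ge1 : 1 <= z by lra.
apply: (@le_trans _ _ (z ^+ (16 * h))); first exact: ler_weXn2l.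
rewrite exprM (@le_trans _ _ ((5 / 2) ^+ h)) //.
  by rewrite lerXn2r ?nnegrE ?exprn_ge0 ?zeta3_expn16 //; lra.
rewrite expr_div_n ler_pdivrMr ?exprn_gt0 // -!natrX -natrM ler_nat //.
Qed.

Lemma clique_admissible_zeta3 (R : realType) :
  clique_admissible 3 (2 * (1 / 3 : R) `^ (1 / 3) * (2 / 3) `^ (2 / 3)).
Proof.
(* For [0 < n < 8] the required bound becomes [(z - z)^n = 0], which the empty graph meets. *)
set z := (_ * _); exists (fun n => if (n < 8)%N then - z else 0).
  apply: cvg_near_cst; exists 8%N => // n /= n8.
  by rewrite ltnNge n8.
move=> n n_gt0; have [n8|n8] := ltnP n 8; last first.
  have [G [Gd Gw Gx]] := triangle_free_large_chromatic R n8.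
  exists G; split=> //; last by rewrite addr0.
  by apply: le_lt_trans Gw _; rewrite lte_fin; lra.
pose noE (T : Type) e : (@set0 (set T)) e -> exists x y,
    [/\ set0 x, set0 y, x <> y & e = [set x; y]%classic] :=
  fun h => match h with end.
exists (SimpleGraph (@noE _)); split.
- by exists 1.
- apply: (@le_lt_trans _ _ 0%E); last by rewrite lte_fin.
  apply: ge_ereal_sup => _ [A [Av _] <-]; rewrite lee_fin lern0.
  rewrite cardfs_eq0; apply/eqP/fsetP => x; rewrite in_fset0; apply/negP => /Av.
  by [].
rewrite subrr expr0n -(prednK n_gt0) /=.
by apply: le_ereal_inf_tmp => _ [m _ <-]; rewrite lee_fin.
Qed.

Theorem theorem3 (R : realType) :
  ((2 * (1 / 3 : R) `^ (1 / 3) * (2 / 3) `^ (2 / 3))%:E <= zeta_clique R 3)%E /\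
  1058 / 1000 <= 2 * (1 / 3 : R) `^ (1 / 3) * (2 / 3) `^ (2 / 3) < 1059 / 1000.
Proof.
split; last exact: zeta3_bounds.
apply: ereal_sup_ubound.
exists (2 * (1 / 3) `^ (1 / 3) * (2 / 3) `^ (2 / 3)) => //.
exact: clique_admissible_zeta3.
Qed.
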